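(* For every positive integer $t$, there is a hereditary weakly sparse class $\mathcal C'_t$ of finite triangle-free graphs of unbounded treewidth such that for every finite triangle-free graph $H$ of treewidth at most $t$, the subclass $\{G \in \mathcal C'_t : G \text{ is } H\text{-free}\}$ has bounded treewidth.
   Context: A graph $G$ is $H$-free if $H$ is not isomorphic to an induced subgraph of $G$. A class is hereditary if it is closed under taking induced subgraphs. A class is weakly sparse if there is a finite integer $s$ such that no graph of the class contains $K_{s,s}$ as a subgraph. A graph is triangle-free if it contains no $K_3$ as a subgraph. *)

(* Defs.v *)
From mathcomp Require Import all_boot.
Set Implicit Arguments. Unset Strict Implicit. Unset Printing Implicit Defensive.

Record sgraph := SGraph {
  nv : nat;
  adj : rel 'I_nv;
  adj_sym : symmetric adj;
  adj_irr : irreflexive adj }.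

Definition induced_sub (H G : sgraph) : Prop :=
  exists f : 'I_(nv H) -> 'I_(nv G),
    injective f /\ forall x y, adj x y = adj (f x) (f y).

Definition H_free (H G : sgraph) : Prop := ~ induced_sub H G.

Definition contains_Kss (G : sgraph) (s : nat) : Prop :=
  exists A B : {set 'I_(nv G)},
    [/\ #|A| = s, #|B| = s, [disjoint A & B] &
        forall a b, a \in A -> b \in B -> adj a b].

Definition triangle_free (G : sgraph) : Prop :=
  forall x y z : 'I_(nv G), ~ [&& adj x y, adj y z & adj x z].

Definition edge_count (m : nat) (e : rel 'I_m) : nat :=
  #|[set p : 'I_m * 'I_m | (p.1 < p.2)%N && e p.1 p.2]|.

Definition is_tree (m : nat) (e : rel 'I_m) : Prop :=
  [/\ (0 < m)%N, symmetric e, irreflexive e,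
      (forall i j, connect e i j) & edge_count e = m.-1].

Definition tree_decomp_width_le (G : sgraph) (w : nat) : Prop :=
  exists (m : nat) (e : rel 'I_m) (bag : 'I_m -> {set 'I_(nv G)}),
    [/\ is_tree e,
        (forall v, exists i, v \in bag i),
        (forall u v, adj u v -> exists i, (u \in bag i) && (v \in bag i)),
        (forall v i j, v \in bag i -> v \in bag j ->
            connect [rel a b | [&& e a b, v \in bag a & v \in bag b]] i j) &
        (forall i, #|bag i| <= w.+1)%N].

Definition tw_le (G : sgraph) (w : nat) : Prop := tree_decomp_width_le G w.

Definition graph_class := sgraph -> Prop.

Definition hereditary (C : graph_class) : Prop :=
  forall G H, C G -> induced_sub H G -> C H.

Definition weakly_sparse (C : graph_class) : Prop :=
  exists s : nat, forall G, C G -> ~ contains_Kss G s.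

Definition bounded_tw (C : graph_class) : Prop :=
  exists k : nat, forall G, C G -> tw_le G k.

(* Main.v *)
Require Import Defs.
From mathcomp Require Import all_boot.
From mathcomp Require Import zify.
Set Implicit Arguments. Unset Strict Implicit. Unset Printing Implicit Defensive.

(** The class consists of the induced subgraphs of layered wheels.  A wheel is
a heap-ordered tree of large arity on an initial segment of the naturals,
together with the Hamiltonian path (the spine) [0, 1, 2, ...] and edges from
vertices to ancestors.  Each vertex remembers at most [t + 2] of its ancestors,
and every possible way of updating this memory and of seeing a subset of the
remembered ancestors occurs among its children; the subset is ignored when it is
not independent, which keeps the wheel triangle-free.

The levels of the tree are consecutive intervals of the spine, pairwise joined
by an edge, so that wheels have large clique minors.

Given an induced subgraph [G] of a wheel, let [rho a] be the least number of
vertices of [G] on a branch going down from [a].  If [rho] is bounded, then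
cheapest branches together with the remembered ancestors are small separators
cutting the tree into nested strips, and the strips form a tree decomposition.
If [rho a] is large, then a graph [H] of treewidth at most [t] is embedded
greedily below [a], along a perfect elimination order of a chordal completion
of [H]: to place [v], descend from the image of the latest vertex among its
earlier neighbours, always towards children seeing exactly the images of the
earlier neighbours of [v], until a vertex of [G] shows up. *)

(** * Treewidth and elimination orders *)

Section RootedTree.
Variables (m : nat) (e : rel 'I_m).
Hypothesis e_tree : is_tree e.

(** With [d] the distance to [r], sending each of the [m.-1] other nodes to the edge above it is
    injective, hence onto by the edge count. So every edge is a parent edge, which is the form in
    which acyclicity gets used. *)
Lemma tree_rooting : exists (r : 'I_m) (p : 'I_m -> 'I_m) (d : 'I_m -> nat),
  [/\ p r = r, d r = 0, (forall k, k != r -> d (p k) < d k) &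
      (forall a b, e a b -> p a = b \/ p b = a)].
Proof.
case: e_tree => m_gt0 e_sym e_irr e_conn e_count.
pose r : 'I_m := Ordinal m_gt0.
have reach k : exists n, [exists s : n.-tuple 'I_m, path e r s && (last r s == k)].
  have /connectP [s s_path ->] := e_conn r k.
  by exists (size s); apply/existsP; exists (in_tuple s); rewrite /= s_path eqxx.
pose d k := ex_minn (reach k).
have down k : k != r -> exists j, e j k && (d j < d k).
  move=> kNr; rewrite /d; case: (ex_minnP (reach k)) => n /existsP [[s /= /eqP s_size]].
  case/andP; elim/last_ind: s s_size => [|s x _] s_size.
    by move=> _ /eqP kr; rewrite /= in kr; rewrite kr eqxx in kNr.
  rewrite rcons_path last_rcons => /andP [s_path ex] /eqP xk _; subst x.
  exists (last r s); rewrite ex /=.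
  case: (ex_minnP (reach (last r s))) => n' _ /(_ (size s)) n'_min.
  move: s_size; rewrite size_rcons => <-; rewrite ltnS; apply: n'_min.
  by apply/existsP; exists (in_tuple s); rewrite /= s_path eqxx.
pose p k := if [pick j | e j k && (d j < d k)] is Some j then j else r.
have pP k : k != r -> e (p k) k /\ d (p k) < d k.
  move=> kNr; rewrite /p; case: pickP => [j /andP [] //|no].
  by case: (down k kNr) => j; rewrite no.
have d_r : d r = 0.
  rewrite /d; case: ex_minnP => n _ /(_ 0) n_min; apply/eqP; rewrite -leqn0 n_min //.
  by apply/existsP; exists [tuple]; rewrite /= eqxx.
have p_r : p r = r.
  by rewrite /p; case: pickP => // j; rewrite d_r ltn0 andbF.
exists r, p, d; split => // [k /pP [] //|].
pose edge_of (k : 'I_m) := if k < p k then (k, p k) else (p k, k).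
pose E := [set x : 'I_m * 'I_m | (x.1 < x.2) && e x.1 x.2].
have edge_inj : {in [set~ r] &, injective edge_of}.
  move=> a b; rewrite !inE => /pP [_ da] /pP [_ db]; rewrite /edge_of.
  case: ifP => _; case: ifP => _ [] // h1 h2.
    by rewrite h2 in da; rewrite -h1 in db; lia.
  by rewrite h1 in da; rewrite -h2 in db; lia.
have edge_sub : edge_of @: [set~ r] \subset E.
  apply/subsetP => x /imsetP [k]; rewrite in_setC1 => kNr ->{x}; have [ek dk] := pP k kNr; rewrite inE.
  rewrite /edge_of; case: ifP => lt_k /=; first by rewrite lt_k e_sym.
  rewrite ek andbT ltn_neqAle leqNgt lt_k andbT.
  by apply: contraTneq dk => /val_inj ->; rewrite ltnn.
have edge_eq : edge_of @: [set~ r] = E.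
  apply/eqP; rewrite eqEcard edge_sub (card_in_imset edge_inj) cardsC1 card_ord.
  have := e_count; rewrite /edge_count -/E => ->; exact: leqnn.
have main (a b : 'I_m) : a < b -> e a b -> p a = b \/ p b = a.
  move=> lt_ab eab; have: (a, b) \in E by rewrite inE /= lt_ab.
  rewrite -edge_eq => /imsetP [k _]; rewrite /edge_of.
  by case: ifP => _ [-> ->]; [left | right].
move=> a b eab; case: (ltngtP a b) => ab; first exact: main.
  by have [] := main b a ab; [rewrite e_sym | right | left].
by rewrite (val_inj ab) e_irr in eab.
Qed.

End RootedTree.

(* [K v] is the clique of earlier neighbours of [v] in a chordal completion
   whose vertices are listed by increasing [key]. *)
Definition elimination_order (G : sgraph) (t : nat)
    (key : 'I_(nv G) -> nat) (K : 'I_(nv G) -> {set 'I_(nv G)}) : Prop :=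
  [/\ injective key,
      (forall u v, u \in K v -> key u < key v),
      (forall u v, adj u v -> key u < key v -> u \in K v),
      (forall u u' v, u \in K v -> u' \in K v -> key u < key u' -> u \in K u') &
      (forall v, #|K v| <= t)].

(** Vertices are ordered by the depth of their topmost bag [top v], and [K v] consists of the
    earlier vertices in that bag. Two vertices sharing a bag both lie in the deeper of their top
    bags, whence the clique condition; omitting [v] itself turns bag size [t.+1] into [t]. *)
Lemma tw_le_elimination_order (G : sgraph) (t : nat) :
  tw_le G t -> exists key K, @elimination_order G t key K.
Proof.
case=> m [e [bag [e_tree cover edges conn size_bag]]].
have [r [p [d [p_r d_r d_p e_p]]]] := tree_rooting e_tree.
have top_ex v : exists k, (v \in bag k) && [forall j, (v \in bag j) ==> (d k <= d j)].
  have [i vi] := cover v.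
  case: (@arg_minnP _ i (fun k => v \in bag k) d vi) => k vk k_min; exists k.
  by rewrite vk; apply/forallP => j; apply/implyP/k_min.
pose top v := xchoose (top_ex v).
have top_bag v : v \in bag (top v) by have /andP [] := xchooseP (top_ex v).
have d_top v k : v \in bag k -> d (top v) <= d k.
  by have /andP [_ /forallP/(_ k)/implyP] := xchooseP (top_ex v).
have d_iter i k : d (iter i p k) <= d k.
  elim: i => //= i IH; apply: leq_trans IH.
  by have [->|/d_p/ltnW//] := eqVneq (iter i p k) r; rewrite p_r.
(* If the parent bag misses [v], a path from [k] through the bags of [v] never leaves the subtree
   below [k]; so [top v] lies there, and its minimal depth makes it [k]. *)
have running v k : v \in bag k -> k = top v \/ v \in bag (p k).
  move=> vk; case: (boolP (v \in bag (p k))) => [|vpk]; [by right | left].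
  have desc_closed s x : path [rel a b | [&& e a b, v \in bag a & v \in bag b]] x s ->
      (exists i, iter i p x = k) -> exists i, iter i p (last x s) = k.
    elim: s x => //= y s IH x /andP [/and3P [exy vx vy] s_path] [i xk].
    apply: IH => //; case: (e_p _ _ exy) => [pxy|pyx].
      case: i xk => [xk|i xk]; first by rewrite -xk pxy vy in vpk.
      by exists i; rewrite -pxy -iterSr.
    by exists i.+1; rewrite iterSr pyx.
  have /connectP [s s_path top_last] := conn _ _ _ vk (top_bag v).
  have [i] := desc_closed _ _ s_path (ex_intro _ 0 erefl); rewrite -top_last.
  case: i => // i ik; have := d_top v k vk; rewrite -{1}ik iterSr.
  have [top_r|/d_p d_lt] := eqVneq (top v) r.
    move=> _; rewrite -ik top_r; elim: i.+1 => //= j ->; exact: p_r.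
  by have := d_iter i (p (top v)); have := d_top v k vk; rewrite -{2}ik iterSr; lia.
have climb v k i : v \in bag k -> d (top v) <= d (iter i p k) -> v \in bag (iter i p k).
  move=> vk; elim: i => //= i IH d_le.
  have [kr|/d_p d_lt] := eqVneq (iter i p k) r.
    by rewrite kr p_r in d_le *; rewrite -kr IH // kr.
  have [k_top|//] := running v (iter i p k) (IH (leq_trans d_le (ltnW d_lt))).
  by rewrite k_top in d_lt d_le; lia.
have reach_top v k : v \in bag k -> exists i, iter i p k = top v.
  have [n] := ubnP (d k); elim: n k => // n IH k; rewrite ltnS => dk vk.
  have [->|vpk] := running v k vk; first by exists 0.
  have [kr|kr] := eqVneq k r.
    have := d_top v k vk; rewrite kr d_r.
    by exists 0; have [<-|/d_p] := eqVneq (top v) r; last lia.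
  have [i ik] := IH (p k) (leq_trans (d_p k kr) dk) vpk.
  by exists i.+1; rewrite iterSr.
have top_common u v k : u \in bag k -> v \in bag k -> d (top u) <= d (top v) ->
    u \in bag (top v).
  by move=> uk vk; have [i <-] := reach_top v k vk; exact: climb.
(* Lexicographic order on depth and index, packed into one number. *)
pose key (v : 'I_(nv G)) := d (top v) * nv G + v.
have key_div v : key v %/ nv G = d (top v).
  have v_lt := ltn_ord v.
  by rewrite divnMDl ?divn_small ?addn0 // (leq_ltn_trans _ v_lt).
have key_d u v : key u < key v -> d (top u) <= d (top v).
  by move=> /ltnW /(leq_div2r (nv G)); rewrite !key_div.
exists key, (fun v => [set u in bag (top v) | key u < key v]); split.
- move=> u v uv; apply/val_inj; move: (uv); rewrite /key.
  by rewrite -(key_div u) -(key_div v) uv => /addnI.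
- by move=> u v; rewrite inE => /andP [].
- move=> u v uv key_uv; rewrite inE key_uv andbT.
  have [k /andP [uk vk]] := edges u v uv; exact: top_common uk vk (key_d _ _ key_uv).
- move=> u u' v; rewrite !inE => /andP [uv _] /andP [u'v _] key_uu'.
  by rewrite key_uu' andbT; exact: top_common uv u'v (key_d _ _ key_uu').
- move=> v; rewrite -ltnS; apply: leq_trans (size_bag (top v)).
  apply/proper_card/properP; split; first by apply/subsetP => u; rewrite inE => /andP [].
  by exists v; rewrite ?top_bag // inE ltnn andbF.
Qed.

(** Connectedness as an induction principle, which avoids handling paths. *)
Definition connected_in (G : sgraph) (B : {set 'I_(nv G)}) : Prop :=
  forall Q : 'I_(nv G) -> Prop,
    (forall u v, u \in B -> v \in B -> adj u v -> Q u -> Q v) ->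
    forall u v, u \in B -> v \in B -> Q u -> Q v.

(* [c] is the latest of the first vertices of the [B a].  Since [K c] separates
   the descendants [D] of [c] from the other vertices, it meets every other [B a]. *)
Lemma elimination_order_minor (G : sgraph) (t n : nat) key K
    (B : 'I_n.+1 -> {set 'I_(nv G)}) :
  @elimination_order G t key K ->
  (forall a, B a != set0) -> (forall a, connected_in (B a)) ->
  (forall a b, a != b -> [disjoint B a & B b]) ->
  (forall a b, a != b -> exists u v, [/\ u \in B a, v \in B b & adj u v]) ->
  n <= t.
Proof.
case=> key_inj K_key K_adj K_clique K_size B_ne B_conn B_disj B_touch.
have min_ex a : exists v, (v \in B a) && [forall u, (u \in B a) ==> (key v <= key u)].
  have /set0Pn [i Bi] := B_ne a; case: (@arg_minnP _ i (fun v => v \in B a) key Bi) => v Bv v_min; exists v.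
  by rewrite Bv; apply/forallP => u; apply/implyP/v_min.
pose low a := xchoose (min_ex a).
have lowB a : low a \in B a by have /andP [] := xchooseP (min_ex a).
have low_min a u : u \in B a -> key (low a) <= key u.
  by have /andP [_ /forallP/(_ u)/implyP] := xchooseP (min_ex a).
case: (arg_maxnP (fun a => key (low a)) (erefl : xpredT (ord0 : 'I_n.+1))) => a0 _ a0_max.
pose c := low a0.
pose D u := exists s, path (fun x y => x \in K y) c s /\ last c s = u.
have D_c : D c by exists [::].
have D_step u z : D z -> z \in K u -> D u.
  move=> [s [s_path s_last]] zu; exists (rcons s u).
  by rewrite rcons_path last_rcons s_path s_last.
have D_key u : D u -> u = c \/ key c < key u.
  case=> s [+ <-]; elim/last_ind: s => [|s x IH]; first by left.
  rewrite rcons_path last_rcons => /andP [/IH c_le /K_key lt_x]; right.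
  by case: c_le => [<-//|/ltn_trans]; exact.
(* Induction along the chain from [c] to [u]: [z] and the predecessor of [u] both lie in the clique
   [K u], so they coincide or the earlier one belongs to the [K] of the other. *)
have D_back u z : D u -> z \in K u -> D z \/ z \in K c.
  case=> s [+ <-]; elim/last_ind: s z => [|s x IH] z; first by right.
  rewrite rcons_path last_rcons => /andP [s_path wx] zx.
  have Dw : D (last c s) by exists s.
  case: (ltngtP (key z) (key (last c s))) => [zw|wz|/key_inj->]; last by left.
    exact: IH s_path (K_clique _ _ _ zx wx zw).
  by left; apply: D_step Dw (K_clique _ _ _ wx zx wz).
have D_adj u v : D u -> adj u v -> D v \/ v \in K c.
  move=> Du uv; case: (ltngtP (key u) (key v)) => [lt_uv|lt_vu|/key_inj <-].
  - by left; apply: D_step Du (K_adj _ _ uv lt_uv).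
  - by apply: D_back Du (K_adj _ _ _ lt_vu); rewrite adj_sym.
  - by left.
have D_spread a u v : [disjoint B a & K c] -> u \in B a -> v \in B a -> D u -> D v.
  move=> dis; apply: B_conn => {u v} u v _ Bv uv Du.
  by case: (D_adj u v Du uv) => // vc; have := disjointFr dis Bv; rewrite vc.
have D_a0 u : u \in B a0 -> D u.
  move=> Bu; apply: D_spread (lowB a0) Bu D_c; rewrite disjoint_subset.
  apply/subsetP => v /low_min; rewrite !inE leqNgt; apply: contra; exact: K_key.
have meet a : a != a0 -> exists v, v \in B a :&: K c.
  move=> aNa0; apply/set0Pn; rewrite setI_eq0; apply/negP => dis.
  have [u [v [Bu Bv uv]]] := B_touch a0 a (contra_neq (@esym _ _ _) aNa0).
  have Dv : D v.
    by case: (D_adj u v (D_a0 u Bu) uv) => // vc; have := disjointFr dis Bv; rewrite vc.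
  case: (D_key _ (D_spread a v (low a) dis Bv (lowB a) Dv)) => [lowE|].
    by have := disjointFr (B_disj a a0 aNa0) (lowB a); rewrite lowE lowB.
  by have := a0_max a isT; rewrite /= -/c; lia.
pose rep a := odflt c [pick v in B a :&: K c].
have repP a : a != a0 -> rep a \in B a :&: K c.
  move=> /meet [v vBK]; rewrite /rep; case: pickP => //= no; by rewrite no in vBK.
have rep_inj : {in [set~ a0] &, injective rep}.
  move=> a b; rewrite !in_setC1 => /repP/setIP [aB _] /repP/setIP [bB _] ab.
  apply/eqP/negPn/negP => aNb; have := disjointFr (B_disj a b aNb) aB.
  by rewrite ab bB.
apply: leq_trans (K_size c); have <- : #|[set~ a0]| = n by rewrite cardsC1 card_ord.
rewrite -(card_in_imset rep_inj); apply/subset_leq_card/subsetP => x /imsetP [a].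
by rewrite in_setC1 => /repP/setIP [_ ?] ->.
Qed.

(* Node [y > 0] of the decomposition tree hangs below node [q y]. *)
Lemma tw_le_parent (G : sgraph) (w m : nat) (q : nat -> nat) (bag : nat -> {set 'I_(nv G)}) :
  0 < m -> (forall y, 0 < y -> q y < y) ->
  (forall v, exists2 y, y < m & v \in bag y) ->
  (forall u v, adj u v -> exists2 y, y < m & (u \in bag y) && (v \in bag y)) ->
  (forall v y, y < m -> v \in bag y ->
     (0 < y /\ v \in bag (q y)) \/ (forall z, z < y -> v \notin bag z)) ->
  (forall y, #|bag y| <= w.+1) ->
  tw_le G w.
Proof.
move=> m_gt0 q_lt cover edges running size_bag.
pose e (a b : 'I_m) := (0 < a) && (q a == b) || (0 < b) && (q b == a).
have e_sym : symmetric e by move=> a b; rewrite /e orbC.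
have q_ltm (y : 'I_m) : 0 < y -> q y < m.
  by move=> /q_lt lt_qy; apply: ltn_trans lt_qy (ltn_ord y).
exists m, e, (fun y : 'I_m => bag y); split.
- split=> //.
  + by move=> a; apply/negP; rewrite /e orbb => /andP [/q_lt lt_q /eqP q_a]; rewrite q_a ltnn in lt_q.
  + pose r := Ordinal m_gt0.
    have to_root y : connect e y r.
      case: y => y; elim/ltn_ind: y => -[|y] IH ym.
        by rewrite (_ : Ordinal ym = r) ?connect0 //; apply: val_inj.
      have qm := q_ltm (Ordinal ym) isT.
      apply: connect_trans (IH _ (q_lt y.+1 isT) qm).
      by apply: connect1; rewrite /e /= eqxx.
    move=> a b; apply: connect_trans (to_root a) _.
    by rewrite sym_connect_sym ?to_root // => x y; exact: e_sym.
  + pose r := Ordinal m_gt0.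
    pose par (y : 'I_m) : 'I_m := odflt r (insub (q y)).
    have parE (y : 'I_m) : 0 < y -> val (par y) = q y.
      by move=> y_gt0; rewrite /par insubT ?q_ltm.
    have <- : #|[set~ r]| = m.-1 by rewrite cardsC1 card_ord.
    have inj : injective (fun y => (par y, y)) by move=> x y [].
    rewrite -(card_imset _ inj); apply: eq_card => -[a b]; rewrite inE /= /e.
    apply/andP/imsetP => [[lt_ab /orP [/andP [a_gt0 /eqP qa]|/andP [b_gt0 /eqP qb]]]|].
    - by have := q_lt a a_gt0; rewrite qa; lia.
    - exists b; first by rewrite in_setC1; apply/eqP => br; rewrite br in b_gt0.
      by congr (_, _); apply: val_inj; rewrite parE.
    - case=> y; rewrite in_setC1 => yNr [-> ->].
      have y_gt0 : 0 < y by rewrite lt0n; apply: contraNneq yNr => y0; apply/eqP/val_inj.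
      by rewrite [par y : nat]parE // q_lt // y_gt0 eqxx orbT.
- by move=> v; have [y ym vy] := cover v; exists (Ordinal ym).
- by move=> u v /edges [y ym uvy]; exists (Ordinal ym).
- move=> v.
  have to_low i j : v \in bag (i : 'I_m) -> v \in bag (j : 'I_m) ->
      (forall z : 'I_m, v \in bag z -> j <= z) ->
      connect [rel a b : 'I_m | [&& e a b, v \in bag a & v \in bag b]] i j.
    case: i => i; elim/ltn_ind: i => i IH im vi vj j_min.
    case: (running v i im vi) => [[i_gt0 vq]|i_min].
      have qm := q_ltm (Ordinal im) i_gt0.
      apply: connect_trans (IH _ (q_lt i i_gt0) qm vq vj j_min).
      by apply: connect1; rewrite /= /e /= i_gt0 eqxx vi vq.
    rewrite (_ : Ordinal im = j) ?connect0 //; apply: val_inj => /=.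
    have := j_min (Ordinal im) vi; rewrite leq_eqVlt => /orP [/eqP //|/i_min].
    by rewrite vj.
  move=> i j vi vj.
  case: (@arg_minnP _ i (fun y => v \in bag y) (fun y => y : nat) vi) => k vk k_min.
  apply: connect_trans (to_low i k vi vk k_min) _.
  rewrite sym_connect_sym ?to_low // => x y /=.
  by rewrite e_sym [X in _ && X]andbC.
- by move=> y.
Qed.

(** * Heap-ordered trees and cheap branches *)

Section Heap.
Variable m : nat.
Hypothesis m_gt0 : 0 < m.

Definition parent (y : nat) : nat := y.-1 %/ m.

Lemma parent0 : parent 0 = 0. Proof. exact: div0n. Qed.

Lemma parent_lt y : 0 < y -> parent y < y.
Proof. by case: y => // y _; rewrite ltnS; exact: leq_div. Qed.

Lemma parent_bounds y : 0 < y -> m * parent y < y <= m * parent y + m.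
Proof.
case: y => // y _; rewrite /parent /= !ltnS {2 3}(divn_eq y m) mulnC leq_addr ltn_add2l.
by rewrite ltn_mod.
Qed.

Lemma parentE a y : m * a < y <= m * a + m -> parent y = a.
Proof.
case: y => // y /andP [lo hi]; rewrite /parent /=; have := divn_eq y m.
have := ltn_pmod y m_gt0; move: (y %/ m) (y %% m) => k r r_lt yE.
by apply/eqP; rewrite eqn_leq; apply/andP; split; nia.
Qed.

Lemma parent_pred y : 1 < y -> parent y.-1 = parent y \/
  parent y = (parent y.-1).+1 /\ y.-1 = m * parent y.-1 + m.
Proof.
move=> y_gt1; have y_gt0 := ltnW y_gt1.
have /andP [lo hi] := parent_bounds y_gt0.
have [y_lo|y_lo] := leqP y (m * parent y).+1; last first.
  by left; apply: parentE; lia.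
have p_gt0 : 0 < parent y by case: (parent y) lo hi y_lo => //; lia.
have pE : parent y.-1 = (parent y).-1 by apply: parentE; nia.
by right; rewrite pE; split; nia.
Qed.

(* [rho a] is the least number of points of [F] on a branch going down from
   [a], and [beta a] is the next vertex of a branch attaining it. *)
Lemma cheapest_branch (F : pred nat) (M : nat) : (forall a, F a -> a < M) ->
  exists (rho beta : nat -> nat),
    [/\ forall a, 0 < beta a /\ parent (beta a) = a,
        forall a, rho a = F a + rho (beta a),
        forall y, 0 < y -> rho (beta (parent y)) <= rho y &
        forall a, M <= a -> rho a = 0].
Proof.
move=> F_lt.
pose o : 'I_m := Ordinal m_gt0.
pose child a (i : 'I_m) := m * a + i.+1.
have child_gt a i : a < child a i by rewrite /child; nia.
have parent_child a i : parent (child a i) = a.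
  by apply: parentE; rewrite /child; have := ltn_ord i; lia.
pose best (r : nat -> nat) a := child a [arg min_(i < o) r (child a i)].
have best_le r a i : r (best r a) <= r (child a i).
  rewrite /best; case: (@arg_minnP _ o xpredT (fun i => r (child a i)) isT) => j _.
  exact.
(* [rk k a] looks [k] vertices down. Points are smaller than [M] and children exceed their parents,
   so the value is stable once [a + k] reaches [M]. *)
pose rk := fix rk k a := if k is k'.+1 then F a + rk k' (best (rk k') a) else 0.
have rkS k a : rk k.+1 a = F a + rk k (best (rk k) a) by [].
have best_child r a : exists i, best r a = child a i by eexists.
have F0 a : M <= a -> F a = false.
  by move=> Ma; apply/negP => /F_lt; rewrite ltnNge Ma.
have rk0 k a : M <= a -> rk k a = 0.
  elim: k a => //= k IH a Ma; rewrite F0 // IH //.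
  by apply: leq_trans Ma (ltnW (child_gt _ _)).
have stable k a : M <= a + k -> rk k a = rk k.+1 a.
  elim: k a => [|k IH] a Mak; first by rewrite [RHS]rk0 // -[a]addn0.
  have eq_r i : rk k (child a i) = rk k.+1 (child a i).
    by apply: IH; have := child_gt a i; lia.
  rewrite [LHS]rkS [RHS]rkS; congr (_ + _); apply/eqP; rewrite eqn_leq; apply/andP; split.
    have [i ->] := best_child (rk k.+1) a; rewrite -eq_r; exact: best_le.
  have [i ->] := best_child (rk k) a; rewrite eq_r; exact: best_le.
exists (rk M), (best (rk M)); split => [a|a|y y_gt0|a /rk0 //].
- by rewrite parent_child; split=> //; apply: leq_ltn_trans (child_gt a _).
- have [Ma|aM] := leqP M a; first by rewrite !rk0 ?F0 //; apply: leq_trans Ma (ltnW (child_gt _ _)).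
  by rewrite stable ?leq_addl.
- have /andP [lo hi] := parent_bounds y_gt0.
  have i_lt : y - (m * parent y).+1 < m by lia.
  have -> : rk M y = rk M (child (parent y) (Ordinal i_lt)).
    by congr (rk M _); rewrite /child /=; lia.
  exact: best_le.
Qed.

End Heap.

(** * Remembered ancestors and the decomposition into strips *)

Section Slots.
Variables (m w : nat) (slot : nat -> 'I_w).
Hypothesis m_gt0 : 0 < m.

(** The first argument is fuel; [y] units suffice because the parent of a positive vertex is
    smaller. *)
Fixpoint active_rec (k y : nat) (s : 'I_w) : nat :=
  if k is k'.+1 then
    if slot y == s then parent m y else active_rec k' (parent m y) s
  else 0.

(* Content of slot [s] at [y]: every vertex writes its parent into its own slot
   and inherits the other slots, which all contain [0] at the root. *)
Definition active (y : nat) (s : 'I_w) : nat := active_rec y y s.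

Lemma activeE y s : active y s = if slot y == s then parent m y else active (parent m y) s.
Proof.
have rec0 k : active_rec k 0 s = 0.
  by elim: k => //= k IH; rewrite parent0 IH; case: ifP.
have fuel k k' x : x <= k -> x <= k' -> active_rec k x s = active_rec k' x s.
  elim: k k' x => [|k IH] [|k'] [|x] // xk xk'; rewrite ?rec0 //=; case: ifP => // _.
  by apply: IH; apply: leq_trans (leq_div _ _) _.
case: y => [|y]; first by rewrite /active /= parent0; case: ifP.
rewrite /active [LHS]/=; case: ifP => // _; apply: fuel => //.
exact: leq_div.
Qed.

Lemma active_lt y s : 0 < y -> m * active y s < y.
Proof.
elim/ltn_ind: y => y IH y_gt0; rewrite activeE.
have /andP [lo _] := parent_bounds m_gt0 y_gt0; case: ifP => // _.
have [->|p_gt0] := posnP (parent m y); first by rewrite muln0.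
by apply: ltn_trans (IH _ (parent_lt m y_gt0) p_gt0) (parent_lt m y_gt0).
Qed.

Lemma active_le y s : active y s <= y.
Proof.
have [->|/(active_lt s)/ltnW] := posnP y; first by [].
by apply: leq_trans; rewrite leq_pmull.
Qed.

(* The bag of [y] separates the part of the wheel squeezed between the branches
   through [y.-1] and [y], and is linked to the bag of the pair
   [(par y).-1, par y] enclosing it. *)
Lemma tw_le_of_light_branches (G : sgraph) (f : 'I_(nv G) -> nat) (M N : nat)
    (rho beta : nat -> nat) :
  injective f -> 0 < M -> (forall v, f v < M) ->
  (forall u v, adj u v -> f u <= f v -> f v = (f u).+1 \/ exists s, active (f v) s = f u) ->
  (forall a, 0 < beta a /\ parent m (beta a) = a) ->
  (forall a, rho a = (a \in codom f) + rho (beta a)) ->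
  (forall a, rho a <= N) ->
  tw_le G (4 * (N + w)).
Proof.
move=> f_inj M_gt0 f_lt f_adj beta_child rhoE rho_le.
have parent_beta a : parent m (beta a) = a by case: (beta_child a).
have beta_bounds a : m * a < beta a <= m * a + m.
  by case: (beta_child a) => b_gt0 pa; have := parent_bounds m_gt0 b_gt0; rewrite pa.
have beta_gt a : a < beta a by have := beta_bounds a; nia.
have iter_gt i x : i + x <= iter i beta x.
  by elim: i => //= i IH; apply: leq_ltn_trans (beta_gt _).
(* The separator at [x]: the points of [G] on the cheapest branch from [x], at most [N] by [rho],
   and the contents of the [w] slots. [M] steps suffice, since each step down increases the
   vertex. *)
pose S x := [seq v <- traject beta x M | v \in codom f] ++ [seq active x s | s : 'I_w].
have S_P x v : (f v \in S x) <->
    (exists i, iter i beta x = f v) \/ (exists s, active x s = f v).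
  rewrite mem_cat mem_filter codom_f /=; split.
    case/orP => [/trajectP [i _ ->]|/codomP [s ->]]; [left | right]; by [exists i | exists s].
  case=> [[i ix]|[s <-]]; apply/orP; last by right; apply: codom_f.
  left; apply/trajectP; exists i => //; have := iter_gt i x; rewrite ix.
  by have := f_lt v; lia.
have size_S x : size (S x) <= N + w.
  rewrite size_cat size_codom card_ord leq_add2r; apply: leq_trans (rho_le x).
  rewrite size_filter; elim: M x {f_lt M_gt0 S S_P} => //= k IH x; rewrite rhoE leq_add2l //.
(* The strip between the branches from [y.-1] and [y] lies left or right of the branch from the
   parent of [y], according to the side of its [beta] on which [y] is; this decides the enclosing
   pair. *)
pose par y := if y <= beta (parent m y) then parent m y else (parent m y).+1.
(* Strips with the same enclosing pair are chained from left to right; the first of them, unless it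
   is the root, hangs below the node of that pair. *)
pose q y := if par y.-1 == par y then y.-1 else par y.
pose cell y := S y.-1 ++ S y.
(* Four separators of size at most [N + w] each, whence the width. *)
pose bag y := [set v | f v \in cell y ++ cell (par y)].
have S_beta x v : f v \in S (beta x) -> f v \in S x.
  rewrite !S_P => -[[i <-]|[s]]; first by left; exists i.+1; rewrite iterSr.
  rewrite activeE parent_beta; case: ifP => _ <-; last by right; exists s.
  by left; exists 0.
have par_cell y : parent m y = par y \/ parent m y = (par y).-1.
  by rewrite /par; case: ifP; [left | right].
have parent_cell y v : f v \in S (parent m y) -> f v \in cell (par y).
  by case: (par_cell y) => -> vS; rewrite mem_cat vS ?orbT.
have q_spec y : 0 < y -> (q y = y.-1 /\ par y.-1 = par y) \/
    [/\ q y = par y, par y < y & y.-1 = beta (par y).-1].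
  move=> y_gt0; rewrite /q; case: eqP => [->|par_neq]; [by left | right].
  have y_gt1 : 1 < y.
    case: y y_gt0 par_neq => [|[|y]] // _ []; rewrite /par /= parent0.
    have -> : parent m 1 = 0 by rewrite /parent div0n.
    by have := beta_gt 0; case: ifP => //; case: ifP.
  have [p_eq|[p_eq y_eq]] := parent_pred m_gt0 y_gt1.
    have gt := beta_gt (parent m y); move: par_neq; rewrite /par p_eq.
    case: (leqP y (beta _)) => le_y; first by rewrite (leq_trans (leq_pred y) le_y).
    case: (leqP y.-1 (beta _)) => [le_y1 _|//]; split=> //=; lia.
  have b_lo := beta_bounds (parent m y.-1); have b_hi := beta_bounds (parent m y).
  have y_le : y <= beta (parent m y) by rewrite p_eq in b_hi *; nia.
  move: par_neq; rewrite /par y_le; case: (leqP y.-1) => [le1 _|_ []]; last by rewrite p_eq.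
  by split=> //; [exact: parent_lt | rewrite p_eq /=; lia].
have par_lew y : par y <= y.
  have := leq_trans (leq_div y.-1 m) (leq_pred y); rewrite -/(parent m y) /par.
  by case: (leqP y (beta _)) => // lt _; apply: ltn_trans (beta_gt _) lt.
have bagP y v : (v \in bag y) = (f v \in S y.-1) || (f v \in S y) || (f v \in cell (par y)).
  by rewrite inE !mem_cat.
have iter_par i x : iter i (parent m) (iter i beta x) = x.
  by elim: i x => // i IH x; rewrite iterSr iterS parent_beta.
have par_le i x : iter i (parent m) x <= x.
  elim: i => //= i IH; apply: leq_trans IH; exact: leq_trans (leq_div _ _) (leq_pred _).
(* Two branches that meet are nested, as ancestors are unique. Since [z < y], the branch from [z]
   passes through [parent m y] and then [y], so the cheapest branch from [parent m y] also goes
   through [y]. *)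
have branch_parent y z v : z < y -> 0 < y -> f v \in S y -> f v \in S z ->
    f v \in S (parent m y).
  move=> zy y_gt0 /S_P [[i iy]|[s sy]] zS; last first.
    by apply/S_P; move: sy; rewrite activeE; case: ifP => _ <-; [left; exists 0 | right; exists s].
  case/S_P: zS => [[j jz]|[s sz]]; last first.
    by have := active_le z s; have := iter_gt i y; rewrite sz iy; lia.
  have [ij|ji] := ltnP i j.
    have yE : iter (j - i) beta z = y.
      by rewrite -(iter_par i (iter _ _ z)) -iterD subnKC ?jz -?iy ?iter_par // ltnW.
    have [k kE] : exists k, j - i = k.+1 by exists (j - i).-1; lia.
    rewrite kE iterS in yE; apply/S_P; left; exists i.+1.
    by rewrite iterSr -yE parent_beta yE.
  have := par_le (i - j) z; rewrite -{1}(iter_par j z) -iterD subnK // jz -iy iter_par.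
  by rewrite leqNgt zy.
apply: (@tw_le_parent G _ M q bag) => //.
- by move=> y y_gt0; case: (q_spec y y_gt0) => [[-> _]|[-> ]] //; rewrite ltn_predL.
- move=> v; exists (f v) => //; rewrite bagP.
  by apply/orP; left; apply/orP; right; apply/S_P; left; exists 0.
- move=> u v; wlog le_uv : u v / f u <= f v => [hw uv|uv].
    case/orP: (leq_total (f u) (f v)) => le; first exact: hw.
    by rewrite adj_sym in uv; have [y] := hw v u le uv; rewrite andbC; exists y.
  exists (f v) => //; rewrite !bagP [in X in _ && X]orbAC; apply/andP; split; last first.
    by apply/orP; right; apply/S_P; left; exists 0.
  apply/orP; left; apply/orP; case: (f_adj u v uv le_uv) => [->|[s su]].
    by left; apply/S_P; left; exists 0.
  by right; apply/S_P; right; exists s.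
- move=> v y _ vy; have [->|y_gt0] := posnP y; first by right.
  have up : f v \in cell (par y) -> v \in bag (q y).
    move=> vc; have [[-> par_q]|[-> _ _]] := q_spec y y_gt0.
      by rewrite bagP par_q vc orbT.
    by move: vc; rewrite mem_cat bagP => ->.
  move: vy; rewrite bagP -orbA orbCA => /or3P [vy|vy|/up]; last by left.
    case: (boolP (has (fun z => v \in bag z) (iota 0 y))) => [|/hasPn no_z]; last first.
      by right=> z zy; apply: no_z; rewrite mem_iota.
    case/hasP=> z; rewrite mem_iota /= => zy vz; left; split=> //; apply: up.
    suff [z' z'y vz'] : exists2 z', z' < y & f v \in S z'.
      exact: parent_cell (branch_parent y z' v z'y y_gt0 vy vz').
    have par_z := par_lew z; move: vz; rewrite bagP => /orP [/orP [vz|vz]|].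
    + by exists z.-1 => //; lia.
    + by exists z.
    + by rewrite mem_cat => /orP [] vz; [exists (par z).-1 | exists (par z)] => //; lia.
  left; split=> //; case: (q_spec y y_gt0) => [[-> _]|[_ _ yE]].
    by rewrite bagP vy orbT.
  by apply: up; rewrite mem_cat S_beta // -yE.
- move=> y; apply: leqW.
  apply: (@leq_trans (size (cell y ++ cell (par y)))); last first.
    have size_cell z : size (cell z) <= 2 * (N + w).
      by rewrite size_cat mul2n -addnn leq_add.
    by rewrite size_cat (_ : 4 = 2 + 2) // mulnDl leq_add.
  rewrite cardE -(size_map f); apply: uniq_leq_size.
    by rewrite map_inj_uniq ?enum_uniq.
  by move=> x /mapP [v + ->]; rewrite mem_enum inE.
Qed.

End Slots.

(** * Layered wheels *)

Section Wheel.
Variables t n : nat.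

(* The copy number only serves to give distinct images to distinct vertices of
   [H]; slot [ord_max] receives the vertices that need not be remembered. *)
Definition label : finType := ('I_n.+1 * 'I_t.+2 * {set 'I_t.+2})%type.
(** The factor two gives each label to two consecutive children of every vertex, one of them odd. *)
Definition arity : nat := 2 * #|label|.
Definition label_of (y : nat) : label :=
  nth (ord0, ord0, set0) (enum label) (y.-1 %% arity)./2.
Definition copy (y : nat) : 'I_n.+1 := (label_of y).1.1.
Definition slot (y : nat) : 'I_t.+2 := (label_of y).1.2.
Definition mask (y : nat) : {set 'I_t.+2} := (label_of y).2.

(* Even vertices see no ancestor, so that no two neighbours on the spine do. *)
Definition sees (x y : nat) : bool :=
  odd y && [exists s in mask y, active arity slot y s == x].
(** Testing with [sees] instead of the edges avoids a recursive definition; the condition is at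
    least as strong as independence in the wheel. *)
Definition independent_mask (y : nat) : bool :=
  [forall s in mask y, forall s' in mask y,
     ~~ sees (active arity slot y s) (active arity slot y s') &&
     ((active arity slot y s).+1 != active arity slot y s')].
Definition down_edge (x y : nat) : bool := (x.+1 == y) || independent_mask y && sees x y.
Definition wheel_edge (x y : nat) : bool := down_edge x y || down_edge y x.

Lemma arity_gt2 : 2 < arity.
Proof.
rewrite /arity !card_prod !card_ord -cardsT -powersetT card_powerset cardsT card_ord.
by have := expn_gt0 2 t.+2; nia.
Qed.

Lemma arity_gt0 : 0 < arity. Proof. exact: ltn_trans arity_gt2. Qed.

Lemma label_child a (l : label) :
  exists y, [/\ 0 < y, parent arity y = a, odd y & label_of y = l].
Proof.
have l_in : l \in enum label by rewrite mem_enum.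
pose i := index l (enum label).
have i_lt : i < #|label| by rewrite cardE index_mem.
have i2_lt : 2 * i < arity by rewrite /arity ltn_mul2l.
exists (a * arity + 2 * i).+1; split => //.
- by rewrite /parent /= divnMDl ?arity_gt0 // divn_small // addn0.
- by rewrite /= oddD /arity !mul2n -doubleMr !odd_double.
- by rewrite /label_of /= modnMDl modn_small // mul2n doubleK nth_index.
Qed.

Lemma sees_lt x y : sees x y -> arity * x < y.
Proof.
case/andP=> y_odd /existsP [s /andP [_ /eqP <-]]; apply: active_lt => //.
  exact: arity_gt0.
by case: y y_odd.
Qed.

Lemma down_edge_lt x y : down_edge x y -> x < y.
Proof.
case/orP => [/eqP <- //|/andP [_ /sees_lt]]; apply: leq_ltn_trans.
exact: leq_pmull arity_gt0.
Qed.

Lemma wheel_edge_sym : symmetric wheel_edge.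
Proof. by move=> x y; rewrite /wheel_edge orbC. Qed.

Lemma wheel_edge_irr : irreflexive wheel_edge.
Proof. by move=> x; apply/negP; rewrite /wheel_edge orbb => /down_edge_lt; rewrite ltnn. Qed.

Lemma wheel_edge_lt x y : x < y -> wheel_edge x y = down_edge x y.
Proof.
by move=> xy; rewrite /wheel_edge orbC; case: (boolP (down_edge y x)) => // /down_edge_lt; lia.
Qed.

(** If [y z] is a spine edge, [y] is even and sees nothing, so [x], [y], [z] are consecutive and
    [sees_lt] forces [x = 0], against [z] being odd. Otherwise [z] sees both [x] and [y], which its
    independent mask excludes. *)
Lemma wheel_triangle x y z : x < y -> y < z ->
  ~ [&& wheel_edge x y, wheel_edge y z & wheel_edge x z].
Proof.
move=> xy yz; rewrite !wheel_edge_lt //; last exact: ltn_trans yz.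
case/and3P=> xy_edge yz_edge /orP [/eqP|/andP [z_ind xz]]; first lia.
have z_odd : odd z by case/andP: xz.
have x_lt := sees_lt xz; case/orP: yz_edge => [/eqP yzE|/andP [_ yz_sees]].
  have y_even : ~~ odd y by rewrite -yzE /= in z_odd.
  case/orP: xy_edge => [/eqP xyE|/andP [_ /andP []]]; last by rewrite (negPf y_even).
  have x0 : x = 0 by have := arity_gt2; nia.
  by rewrite -yzE -xyE x0 in z_odd.
case/andP: xz => _ /existsP [s /andP [sz /eqP xE]].
case/andP: yz_sees => _ /existsP [s' /andP [s'z /eqP yE]].
have /forall_inP/(_ s sz)/forall_inP/(_ s' s'z) := z_ind; rewrite xE yE => /andP [no_see no_next].
by case/orP: xy_edge => [|/andP [_]]; [apply/negP | apply/negP].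
Qed.

(** * Greedy embedding below a vertex with heavy branches *)

Section Embedding.
Variables (G H : sgraph) (f : 'I_(nv G) -> nat) (M : nat) (rho beta : nat -> nat).
Hypothesis f_edge : forall u v, adj u v = wheel_edge (f u) (f v).
Hypothesis rhoE : forall a, rho a = (a \in codom f) + rho (beta a).
Hypothesis rho_child : forall y, 0 < y -> rho (beta (parent arity y)) <= rho y.
Hypothesis rho0 : forall a, M <= a -> rho a = 0.

(* The branch continues through children writing into the junk slot, at no cost
   in [rho], until it meets the image of [f]. *)
Lemma descend b j c (S : {set 'I_t.+2}) k : 0 < k -> k < rho b ->
  exists x, [/\ x \in codom f, odd x /\ copy x = c, mask x = S, k <= rho x &
    forall s, s != ord_max ->
      active arity slot x s = if j == s then b else active arity slot b s].
Proof.
move=> k_gt0 k_lt.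
(* [d] bounds [M - y]: from [M] on [rho] vanishes while [k] is positive, so the descent must stop
   earlier. *)
have go d y : M - y <= d -> odd y -> copy y = c -> mask y = S -> k <= rho y ->
    (forall s, s != ord_max ->
      active arity slot y s = if j == s then b else active arity slot b s) ->
    exists x, [/\ x \in codom f, odd x /\ copy x = c, mask x = S, k <= rho x &
      forall s, s != ord_max ->
        active arity slot x s = if j == s then b else active arity slot b s].
  elim: d y => [|d IH] y yd y_odd y_copy y_mask y_rho y_act.
    by rewrite rho0 ?leqn0 in y_rho; [rewrite (eqP y_rho) in k_gt0 | lia].
  have [y_in|y_out] := boolP (y \in codom f); first by exists y.
  have yM : y < M by rewrite ltnNge; apply/negP => /rho0 r0; rewrite r0 leqNgt k_gt0 in y_rho.
  have rho_y : rho y = rho (beta y) by rewrite rhoE (negPf y_out).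
  have [z [z_gt0 z_par z_odd z_label]] := label_child y (c, ord_max, S).
  apply: (IH z) => //; rewrite ?/copy ?/mask ?z_label //.
  - by have := parent_lt arity z_gt0; rewrite z_par; lia.
  - by apply: leq_trans (rho_child z_gt0); rewrite z_par -rho_y.
  - move=> s sNmax; rewrite activeE /slot z_label z_par /= eq_sym (negPf sNmax).
    exact: y_act.
have [y [y_gt0 y_par y_odd y_label]] := label_child b (c, j, S).
apply: (go (M - y) y) => //; rewrite ?/copy ?/mask ?y_label //.
- by apply: leq_trans (rho_child y_gt0); rewrite y_par; rewrite rhoE in k_lt; case: (_ \in _) k_lt; lia.
- by move=> s _; rewrite activeE /slot y_label y_par.
Qed.

Lemma heavy_branches_embed (N a : nat) key K :
  @elimination_order H t key K -> triangle_free H -> nv H <= n.+1 ->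
  (forall v, key v < N) -> N < rho a -> induced_sub H G.
Proof.
move=> [key_inj K_key K_adj K_clique K_size] H_free H_size key_N rho_a.
pose tag (v : 'I_(nv H)) : 'I_n.+1 := inord v.
have tag_inj : injective tag.
  move=> u v /(congr1 val); rewrite /= !inordK; first exact: val_inj.
    by apply: leq_trans H_size.
  by apply: leq_trans H_size.
(* Invariant: odd images are never consecutive, copy numbers keep them distinct, the mask selects
   the slots of the earlier neighbours, and [rho] keeps enough budget for the later keys. [c]
   colours the completion properly by non-junk slots, and at [x v] the slots of [K v] still hold the
   right images. *)
pose placed (x : 'I_(nv H) -> nat) (c : 'I_(nv H) -> 'I_t.+2) v :=
  [/\ x v \in codom f, odd (x v) /\ copy (x v) = tag v,
      mask (x v) = c @: [set u in K v | adj u v], N - key v <= rho (x v) &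
      [/\ c v != ord_max, forall u, u \in K v -> c u != c v &
          forall u, u \in K v -> active arity slot (x v) (c u) = x u]].
have build i : exists x c, forall v, key v < i -> placed x c v.
  elim: i => [|i [x [c xcP]]]; first by exists (fun=> 0), (fun=> ord0).
  case: (pickP (fun v => key v == i)) => [v /eqP v_key|no_v]; last first.
    exists x, c => v; rewrite ltnS leq_eqVlt => /orP [vi|]; last exact: xcP.
    by rewrite no_v in vi.
  (* Descend from the image of the latest [q] in [K v], to be written into the slot of [q]. The rest
     of [K v] lies in [K q], so its slots are already correct and differ from that one. If [K v] is
     empty, start at [a] with any slot. *)
  have [b [j [b_rho b_act]]] : exists b j, N - key v < rho b /\
      forall u, u \in K v -> (if j == c u then b else active arity slot b (c u)) = x u.
    have [K0|/set0Pn [u0 u0K]] := eqVneq (K v) set0.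
      by exists a, ord0; split=> [|u]; [lia | rewrite K0 inE].
    case: (@arg_maxnP _ u0 (fun u => u \in K v) key u0K) => q qK q_max.
    have q_lt := K_key _ _ qK; rewrite v_key in q_lt.
    have [_ _ _ q_rho [_ q_col q_act]] := xcP q q_lt.
    exists (x q), (c q); split; first by have := key_N v; lia.
    move=> u uK; have [->|uNq] := eqVneq u q; first by rewrite eqxx.
    have u_q : u \in K q.
      apply: (K_clique _ _ _ uK qK); rewrite ltn_neqAle (q_max u uK : key u <= key q) andbT.
      by apply: contraNneq uNq => /key_inj ->.
    by rewrite eq_sym (negPf (q_col u u_q)) q_act.
  (* Of the [t.+2] slots, at most [t] are taken by [K v] and one is junk. *)
  have [col [col_max col_new]] : exists col : 'I_t.+2,
      col != ord_max /\ forall u, u \in K v -> c u != col.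
    have /existsP [col] : [exists col, col \notin ord_max |: c @: K v].
      rewrite -negb_forall; apply/negP => /forallP full.
      have := subset_leq_card (introT subsetP (fun x (_ : x \in setT) => full x)).
      rewrite cardsT card_ord cardsU1 => too_many.
      have image_size : #|c @: K v| <= t.
        by apply: leq_trans (K_size v); exact: leq_imset_card.
      by move: too_many; case: (_ \notin _); lia.
    rewrite !inE negb_or => /andP [col_max col_new]; exists col; split=> // u uK.
    by apply: contraNneq col_new => <-; exact: imset_f.
  have k_gt0 : 0 < N - key v by rewrite subn_gt0.
  have [X [X_in X_odd X_mask X_rho X_act]] :=
    descend j (tag v) (c @: [set u in K v | adj u v]) k_gt0 b_rho.
  exists (fun u => if u == v then X else x u), (fun u => if u == v then col else c u) => u.
  have old w : key w < i -> (w == v) = false.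
    by move=> wi; apply/eqP => wv; rewrite wv v_key ltnn in wi.
  have oldK w w' : key w' <= i -> w \in K w' -> (w == v) = false.
    by move=> wi /K_key wK; apply: old; lia.
  rewrite ltnS leq_eqVlt => u_i; have {u_i} [uv|u_i] : u = v \/ key u < i.
    by case/orP: u_i => [/eqP u_i|]; [left; apply: key_inj; rewrite v_key | right].
  - subst u; have vi : key v <= i by rewrite v_key.
    rewrite /placed eqxx; split=> //.
      rewrite X_mask; apply: eq_in_imset => u; rewrite inE => /andP [uK _].
      by rewrite (oldK u v).
    split=> // u uK; rewrite (oldK u v) // ?col_new //.
    rewrite X_act ?b_act //; have := K_key _ _ uK; rewrite v_key => /xcP [_ _ _ _ []] //.
  - have [xu1 xu2 xu3 xu4 [xu5 xu6 xu7]] := xcP u u_i.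
    rewrite /placed old //; split=> //.
      rewrite xu3; apply: eq_in_imset => u'; rewrite inE => /andP [u'K _].
      by rewrite (oldK u' u) // ltnW.
    split=> [//|u' u'K|u' u'K]; rewrite (oldK u' u (ltnW u_i) u'K).
      exact: xu6.
    exact: xu7.
have [x [c xcP']] := build N; have xcP v := xcP' v (key_N v).
have x_odd v : odd (x v) by case: (xcP v) => _ [].
have x_inj : injective x.
  by move=> u v uv; apply: tag_inj; case: (xcP u) => _ [_ <-] _ _ _; case: (xcP v) => _ [_ <-]; rewrite uv.
have sees_x z v : sees z (x v) -> exists u, [/\ u \in K v, adj u v & x u = z].
  case: (xcP v) => _ _ v_mask _ [_ _ v_act].
  case/andP=> _ /existsP [s /andP []]; rewrite v_mask => /imsetP [u]; rewrite inE => /andP [uK uv] ->.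
  by rewrite v_act // => /eqP; exists u.
(* The earlier neighbours of [v] are pairwise nonadjacent as [H] is triangle-free, and their odd
   images are not consecutive. *)
have x_ind v : independent_mask (x v).
  case: (xcP v) => _ _ v_mask _ [_ _ v_act].
  apply/forall_inP => s; rewrite v_mask => /imsetP [u]; rewrite inE => /andP [uK uv] ->.
  apply/forall_inP => s' /imsetP [u']; rewrite inE => /andP [u'K u'v] ->.
  rewrite !v_act //; apply/andP; split; last first.
    by apply/eqP => next; have := x_odd u'; rewrite -next /= x_odd.
  apply/negP => /sees_x [u'' [_ u''u' /x_inj uE]]; rewrite uE in u''u'.
  by apply: (H_free u u' v); rewrite u''u' u'v uv.
have x_adj u v : adj u v = wheel_edge (x u) (x v).
  wlog key_uv : u v / key u < key v => [hw|].
    case: (ltngtP (key u) (key v)) => [|vu|/key_inj->]; first exact: hw.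
      by rewrite adj_sym wheel_edge_sym hw.
    by rewrite adj_irr wheel_edge_irr.
  rewrite /wheel_edge /down_edge !x_ind /=.
  have no_next u' v' : ((x u').+1 == x v') = false.
    by apply/eqP => next; have := x_odd v'; rewrite -next /= x_odd.
  have no_back : sees (x v) (x u) = false.
    by apply/negP => /sees_x [w [/K_key wu _ /x_inj wE]]; rewrite wE in wu; lia.
  rewrite !no_next no_back /= orbF; apply/idP/idP => [uv|/sees_x [w [_ wv /x_inj <-]]] //.
  case: (xcP v) => _ _ v_mask _ [_ _ v_act]; rewrite /sees x_odd; apply/existsP; exists (c u).
  have uK := K_adj _ _ uv key_uv.
  by rewrite v_act // eqxx andbT v_mask; apply: imset_f; rewrite inE uK.
have /fin_all_exists [g gP] : forall v, exists u, f u = x v.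
  by move=> v; case: (xcP v) => /codomP [u ->] *; exists u.
exists g; split; first by move=> u v guv; apply: x_inj; rewrite -!gP guv.
by move=> u v; rewrite f_edge !gP.
Qed.
End Embedding.

(** * Triangles, bicliques and clique minors in wheels *)

Lemma wheel_sub_triangle_free (G : sgraph) (f : 'I_(nv G) -> nat) :
  (forall u v, adj u v = wheel_edge (f u) (f v)) -> triangle_free G.
Proof.
move=> f_edge x y z; rewrite !f_edge; move: (f x) (f y) (f z) => {x y z} x y z.
case/and3P=> xy yz xz.
have yx : wheel_edge y x by rewrite wheel_edge_sym.
have zy : wheel_edge z y by rewrite wheel_edge_sym.
have zx : wheel_edge z x by rewrite wheel_edge_sym.
case: (ltngtP x y) => [lt_xy|lt_yx|xyE]; last by rewrite xyE wheel_edge_irr in xy.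
- case: (ltngtP y z) => [lt_yz|lt_zy|yzE]; last by rewrite yzE wheel_edge_irr in yz.
    by apply: (wheel_triangle lt_xy lt_yz); rewrite xy yz xz.
  case: (ltngtP x z) => [lt_xz|lt_zx|xzE]; last by rewrite xzE wheel_edge_irr in xz.
    by apply: (wheel_triangle lt_xz lt_zy); rewrite xy zy xz.
  by apply: (wheel_triangle lt_zx lt_xy); rewrite xy zy zx.
- case: (ltngtP x z) => [lt_xz|lt_zx|xzE]; last by rewrite xzE wheel_edge_irr in xz.
    by apply: (wheel_triangle lt_yx lt_xz); rewrite yx yz xz.
  case: (ltngtP y z) => [lt_yz|lt_zy|yzE]; last by rewrite yzE wheel_edge_irr in yz.
    by apply: (wheel_triangle lt_yz lt_zx); rewrite yx yz zx.
  by apply: (wheel_triangle lt_zy lt_yx); rewrite yx zy zx.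
Qed.

(* Every vertex has at most [t + 3] smaller neighbours. *)
Lemma wheel_sub_sparse (G : sgraph) (f : 'I_(nv G) -> nat) :
  injective f -> (forall u v, adj u v = wheel_edge (f u) (f v)) ->
  ~ contains_Kss G t.+4.
Proof.
move=> f_inj f_edge [A [B [A_size B_size _ AB]]].
have few v (U : {set 'I_(nv G)}) :
    (forall u, u \in U -> adj u v) -> (forall u, u \in U -> f u <= f v) -> #|U| <= t.+3.
  move=> U_adj U_le; pose back := (f v).-1 :: [seq active arity slot (f v) s | s : 'I_t.+2].
  apply: (@leq_trans (size back)); last by rewrite /= size_codom card_ord.
  rewrite cardE -(size_map f); apply: uniq_leq_size.
    by rewrite map_inj_uniq ?enum_uniq.
  move=> x /mapP [u + ->]; rewrite mem_enum => uU.
  have uv := U_adj u uU; have lt_uv : f u < f v.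
    rewrite ltn_neqAle U_le // andbT; apply: contraTneq uv => /f_inj ->.
    by rewrite adj_irr.
  move: uv; rewrite f_edge wheel_edge_lt // inE => /orP [/eqP <-|]; first by rewrite eqxx.
  case/and3P=> _ _ /existsP [s /andP [_ /eqP <-]]; rewrite codom_f orbT //.
have [a aA] : exists a, a \in A by apply/set0Pn; rewrite -card_gt0 A_size.
have aAB : a \in A :|: B by rewrite inE aA.
case: (@arg_maxnP _ a (fun v => v \in A :|: B) f aAB) => v vAB v_max.
have v_le u : u \in A :|: B -> f u <= f v := v_max u.
move: vAB; rewrite inE => /orP [vA|vB].
- suff: #|B| <= t.+3 by rewrite B_size ltnn.
  apply: (few v) => u uB; first by rewrite adj_sym AB.
  by apply: v_le; rewrite inE uB orbT.
- suff: #|A| <= t.+3 by rewrite A_size ltnn.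
  apply: (few v) => u uA; first by rewrite AB.
  by apply: v_le; rewrite inE uA.
Qed.

(* First vertex of depth [i]. *)
Fixpoint level (i : nat) : nat := if i is i'.+1 then (arity * level i').+1 else 0.

Lemma level_ltS i : level i < level i.+1.
Proof. by rewrite /= ltnS leq_pmull // arity_gt0. Qed.

Lemma level_le i j : i <= j -> level i <= level j.
Proof. by apply: (homo_leq leqnn leq_trans) => k; exact: ltnW (level_ltS k). Qed.

Lemma level_child i x y : 0 < y -> parent arity y = x ->
  level i <= x < level i.+1 -> level i.+1 <= y < level i.+2.
Proof.
move=> y_gt0 <- /andP [lo hi]; have /andP [] := parent_bounds arity_gt0 y_gt0.
rewrite [level i.+1]/= [level i.+2]/= in hi *; move: (parent _ _) hi lo => x' hi lo y_lo y_hi.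
by apply/andP; split; nia.
Qed.

Definition wheel : sgraph :=
  @SGraph (level n.+1) (fun x y => wheel_edge x y)
    (fun x y => wheel_edge_sym x y) (fun x => wheel_edge_irr x).

(** A child of [level i] writes it into slot [ord0]; further children writing into the junk slot
    keep it there down to any deeper level. The mask with the single slot [ord0] is independent. *)
Lemma level_edge i k :
  exists2 y, level (i + k).+1 <= y < level (i + k).+2 & wheel_edge (level i) y.
Proof.
have [y [y_lv y_odd y_mask y_act]] : exists y, [/\ level (i + k).+1 <= y < level (i + k).+2,
    odd y, mask y = [set ord0] & active arity slot y ord0 = level i].
  elim: k => [|k [x [x_lv x_odd x_mask x_act]]].
    have [y [y_gt0 y_par y_odd y_label]] := label_child (level i) (ord0, ord0, [set ord0]).
    exists y; rewrite /mask y_label addn0; split=> //.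
      by apply: level_child y_gt0 y_par _; rewrite leqnn level_ltS.
    by rewrite activeE /slot y_label eqxx y_par.
  have [y [y_gt0 y_par y_odd y_label]] := label_child x (ord0, ord_max, [set ord0]).
  exists y; rewrite /mask y_label addnS; split=> //; first exact: level_child y_gt0 y_par x_lv.
  by rewrite activeE /slot y_label y_par.
exists y => //; rewrite /wheel_edge /down_edge.
have -> : sees (level i) y.
  by rewrite /sees y_odd; apply/existsP; exists ord0; rewrite y_mask y_act inE !eqxx.
suff -> : independent_mask y by rewrite orbT.
apply/forall_inP => s; rewrite y_mask => /set1P ->; apply/forall_inP => s' /set1P ->.
rewrite y_act gtn_eqF // andbT; apply/negP => /sees_lt.
by rewrite ltnNge leq_pmull // arity_gt0.
Qed.

(** The [n.+1] levels are the branch sets of a clique minor: spine intervals are connected, and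
    [level_edge] joins any two levels. *)
Lemma wheel_elimination_order d key K : @elimination_order wheel d key K -> n <= d.
Proof.
move=> order.
pose B (a : 'I_n.+1) : {set 'I_(nv wheel)} := [set x : 'I_(nv wheel) | level a <= x < level a.+1].
have B_P a (x : 'I_(nv wheel)) : (x \in B a) = (level a <= x < level a.+1) by rewrite inE.
have level_lt (a : 'I_n.+1) y : y < level a.+1 -> y < level n.+1.
  by move=> /leq_trans -> //; exact: level_le.
have disj (a b : 'I_n.+1) : a < b -> [disjoint B a & B b].
  move=> ab; rewrite disjoint_subset; apply/subsetP => x; rewrite B_P => /andP [_ hi].
  rewrite inE B_P negb_and -ltnNge; apply/orP; left.
  exact: leq_trans hi (level_le ab).
have touch (a b : 'I_n.+1) : a < b -> exists u v, [/\ u \in B a, v \in B b & adj u v].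
  move=> ab; have [y] := level_edge a (b - a).-1.
  rewrite -addnS prednK ?subn_gt0 // subnKC ?(ltnW ab) // => y_lv ay.
  have /andP [_ y_hi] := y_lv.
  exists (Ordinal (level_lt a _ (level_ltS a))), (Ordinal (level_lt b y y_hi)).
  by rewrite !B_P /= leqnn level_ltS.
apply: (elimination_order_minor (B := B) order).
- move=> a; apply/set0Pn; exists (Ordinal (level_lt a _ (level_ltS a))).
  by rewrite B_P /= leqnn level_ltS.
- move=> a Q Q_adj u v; rewrite !B_P => uB vB.
  have walk k (x y : 'I_(nv wheel)) : x + k = y -> x \in B a -> y \in B a ->
      (Q x -> Q y) /\ (Q y -> Q x).
    elim: k y => [|k IH] y xy xB yB.
      by rewrite addn0 in xy; rewrite (val_inj xy).
    have zm : x + k < nv wheel by apply: leq_trans (ltn_ord y); rewrite -xy addnS.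
    have zB : Ordinal zm \in B a.
      move: xB yB; rewrite !B_P -xy => /andP [lo _] /andP [_ hi]; apply/andP; split.
        exact: leq_trans lo (leq_addr _ _).
      by apply: leq_ltn_trans hi; rewrite leq_add2l.
    have [xz zx] := IH (Ordinal zm) erefl xB zB.
    have zy : adj (Ordinal zm) y by rewrite /= /wheel_edge /down_edge /= -xy addnS eqxx.
    split; first by move=> /xz; exact: Q_adj zy.
    by move=> Qy; apply/zx/(Q_adj y) => //; rewrite adj_sym.
  case: (leqP u v) => uv; [have := walk (v - u) u v | have := walk (u - v) v u].
    by rewrite subnKC // !B_P => /(_ erefl uB vB) [].
  by rewrite subnKC ?(ltnW uv) // !B_P => /(_ erefl vB uB) [].
- move=> a b; rewrite neq_ltn => /orP [|/disj]; first exact: disj.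
  by rewrite disjoint_sym.
- move=> a b; rewrite neq_ltn => /orP [|/touch [u [v [uB vA uv]]]]; first exact: touch.
  by exists v, u; rewrite adj_sym.
Qed.

End Wheel.

(** * Bounded treewidth of the [H]-free subclasses *)

Lemma tw_le_mono (G : sgraph) (w w' : nat) : w <= w' -> tw_le G w -> tw_le G w'.
Proof.
move=> ww' [m [e [bag [tree cover edges conn size_bag]]]]; exists m, e, bag; split=> // i.
exact: leq_trans (size_bag i) _.
Qed.

Lemma tw_le_card (G : sgraph) : tw_le G (nv G).
Proof.
apply: (@tw_le_parent G (nv G) 1 predn (fun=> setT)) => //.
- by move=> y; rewrite ltn_predL.
- by move=> v; exists 0; rewrite ?inE.
- by move=> u v _; exists 0; rewrite ?inE.
- by move=> v [|y] // _ _; right.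
- by move=> _; rewrite cardsT card_ord.
Qed.

Lemma H_free_wheel_sub_tw (t : nat) (H : sgraph) : triangle_free H -> tw_le H t ->
  bounded_tw (fun G => (exists n, induced_sub G (wheel t n)) /\ H_free H G).
Proof.
move=> H_tri /tw_le_elimination_order [key [K order]].
pose N := (\max_v key v).+1.
have key_N v : key v < N by rewrite ltnS; exact: leq_bigmax.
exists (maxn (\max_(i < nv H) level t i i.+1) (4 * (N + t.+2))) => G [[n [g [g_inj g_adj]]] H_G].
pose f v : nat := g v.
have f_inj : injective f by move=> u v /val_inj /g_inj.
have f_lt v : f v < level t n n.+1 := ltn_ord (g v).
(* Only finitely many wheels have [n < nv H]; their vertex counts bound the treewidth. All others
   have enough copy numbers to embed [H]. *)
have [H_big|H_small] := ltnP n (nv H).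
  apply: tw_le_mono (tw_le_card G); rewrite leq_max; apply/orP; left.
  apply: (@leq_trans (level t n n.+1)).
    by have := leq_card g g_inj; rewrite !card_ord.
  exact: (@leq_bigmax _ (fun i : 'I_(nv H) => level t i i.+1) (Ordinal H_big)).
have codom_lt a : a \in codom f -> a < level t n n.+1 by case/codomP=> v ->; exact: f_lt.
have [rho [beta [beta_child rhoE rho_child rho0]]] :=
  cheapest_branch (arity_gt0 t n) codom_lt.
have [/existsP [a rho_a]|light] := boolP [exists a : 'I_(level t n n.+1), N < rho a].
  by case: H_G; apply: (heavy_branches_embed (f := f) g_adj rhoE rho_child rho0 order
    H_tri (leqW H_small) key_N rho_a).
apply: (@tw_le_mono _ (4 * (N + t.+2))); first exact: leq_maxr.
apply: (tw_le_of_light_branches (slot := @slot t n) (arity_gt0 t n) f_inj _ f_lt _ beta_child rhoE).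
- exact: leq_ltn_trans (level_ltS t n n).
- move=> u v uv; rewrite leq_eqVlt => /orP [/eqP /f_inj uvE|lt_uv].
    by rewrite uvE adj_irr in uv.
  have := uv; rewrite g_adj /= wheel_edge_lt // => /orP [/eqP uvE|]; first by left; exact: esym.
  by case/and3P=> _ _ /existsP [s /andP [_ /eqP]]; right; exists s.
- move=> a; have [/rho0 -> //|a_lt] := leqP (level t n n.+1) a.
  by rewrite leqNgt; apply: contra light => rho_a; apply/existsP; exists (Ordinal a_lt).
Qed.

Theorem theorem1p3 :
  forall t : nat, (0 < t)%N ->
  exists C' : graph_class,
    [/\ hereditary C',
        weakly_sparse C',
        (forall G, C' G -> triangle_free G),
        ~ bounded_tw C' &
        forall H : sgraph, triangle_free H -> tw_le H t ->
          bounded_tw (fun G => C' G /\ H_free H G)].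
Proof.
move=> t _; exists (fun G => exists n, induced_sub G (wheel t n)); split.
- move=> G H [n [g [g_inj g_adj]]] [h [h_inj h_adj]]; exists n, (g \o h).
  by split=> [|x y]; [exact: inj_comp | rewrite h_adj g_adj].
- exists t.+4 => G [n [g [g_inj g_adj]]].
  apply: (@wheel_sub_sparse t n G (fun v => g v)) => // u v /val_inj; exact: g_inj.
- move=> G [n [g [_ g_adj]]]; exact: (@wheel_sub_triangle_free t n G (fun v => g v)).
- case=> k tw_k.
  have /tw_le_elimination_order [key [K order]] : tw_le (wheel t k.+1) k.
    by apply: tw_k; exists k.+1; exists id; split=> [x y|].
  by have := wheel_elimination_order order; rewrite ltnn.
- exact: H_free_wheel_sub_tw.
Qed.
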